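(* Let $S_{ij}=\sqrt{2/(k+2)}\,\sin\bigl(\pi(i+1)(j+1)/(k+2)\bigr)$ for $0\le i,j\le k$ be the character $S$-matrix of $L(k,0)$. For every $\lambda_1,\dots,\lambda_n\in\{0,\dots,k\}$ (both sides automatically vanishing when $\lambda_1+\cdots+\lambda_n$ is odd, by the parity obstruction recalled in the context), $$\dim\mathrm{Bl}(\lambda_1,\dots,\lambda_n)=\sum_{j=0}^k\frac{\prod_{i=1}^nS_{\lambda_ij}}{S_{0j}^{\,n}}.$$ In particular, for $n=2$ and $\lambda_1=\lambda_2=k$ (so $k$ is automatically even by the parity obstruction), $\dim\mathrm{Bl}(k,k)=k+1$, realized by the chains $(\mu_0,\mu_1)=(\mu_0,k-\mu_0)$, $\mu_0=0,1,\dots,k$.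
   Context: $L(k,0)$ is the simple affine vertex operator algebra of $\mathfrak{sl}(2)$ at non-negative integral level $k$, with simple modules $L(k,\mu)$, $0\le\mu\le k$; $n\ge1$. The space of intertwining operators $I\binom{L(k,\nu)}{L(k,\lambda),L(k,\mu)}$ has dimension $N^\nu_{\lambda\mu}$, where $N^\nu_{\lambda\mu}=1$ if $|\lambda-\mu|\le\nu\le\min\{\lambda+\mu,2k-\lambda-\mu\}$ and $\lambda+\mu+\nu$ is even, and $N^\nu_{\lambda\mu}=0$ otherwise. The conformal block space is $$\mathrm{Bl}(\lambda_1,\dots,\lambda_n)=\bigoplus_{\mu_0,\dots,\mu_{n-1}=0}^{k}I\tbinom{L(k,\mu_1)}{L(k,\lambda_1),L(k,\mu_0)}\otimes I\tbinom{L(k,\mu_2)}{L(k,\lambda_2),L(k,\mu_1)}\otimes\cdots\otimes I\tbinom{L(k,\mu_0)}{L(k,\lambda_n),L(k,\mu_{n-1})}.$$ A (two-point fusion) chain of type $(\lambda_1,\lambda_2)$ is a pair $(\mu_0,\mu_1)$ with $N^{\mu_1}_{\lambda_1\mu_0}=N^{\mu_0}_{\lambda_2\mu_1}=1$; more generally an $n$-point fusion chain of type $(\lambda_1,\dots,\lambda_n)$ is a tuple $(\mu_0,\dots,\mu_{n-1})$ with $N^{\mu_i}_{\lambda_i\mu_{i-1}}=1$ for $i=1,\dots,n$, where $\mu_n=\mu_0$. Parity obstruction: a two-point fusion chain of type $(\lambda_1,\lambda_2)$ exists only if $\lambda_1+\lambda_2$ is even, and an $n$-point fusion chain of type $(\lambda_1,\dots,\lambda_n)$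 exists only if $\lambda_1+\cdots+\lambda_n$ is even.
   Formalization: The parenthetical claim that k is automatically even when n=2 and both weights equal k is dropped, since it is false (for k=1 the chains (0,1) and (1,0) of type (1,1) exist); the formula dim Bl(k,k)=k+1 and its chains are stated for every k. *)

(* Defs.v *)
From HB Require Import structures.
From mathcomp Require Export all_boot all_order all_algebra.
From mathcomp Require Export all_classical all_reals all_analysis.
From mathcomp Require Export complex.

Set Implicit Arguments.
Unset Strict Implicit.
Unset Printing Implicit Defensive.

Import Order.TTheory GRing.Theory Num.Theory.
Local Open Scope classical_set_scope.
Local Open Scope ring_scope.

(* Linear algebra over lmodType: the spaces below are subspaces of infinite-
   dimensional function spaces, so finite dimension is a statement rather than
   a vectType structure. *)

Definition has_dim (K : fieldType) (M : lmodType K) (d : nat) : Prop :=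
  inhabited (Vector.axiom d M).

Definition multilinear (K : fieldType) (I : finType) (A : I -> lmodType K)
    (T : lmodType K) (t : (forall i, A i) -> T) : Prop :=
  forall (i : I) (v : forall j, A j), linear (fun x : A i => t (@dfwith I A v i x)).

Record tensorProduct (K : fieldType) (I : finType) (A : I -> lmodType K) :=
  TensorProduct {
    tensor_space :> lmodType K;
    pure_tensor : (forall i, A i) -> tensor_space;
    pure_tensor_multilinear : multilinear pure_tensor;
    tensor_universal : forall (W : lmodType K) (g : (forall i, A i) -> W),
      multilinear g ->
      exists h : {linear tensor_space -> W},
        (forall v, h (pure_tensor v) = g v) /\
        (forall h' : {linear tensor_space -> W},
           (forall v, h' (pure_tensor v) = g v) -> h' =1 h)
  }.

Record directSum (K : fieldType) (I : finType) (A : I -> lmodType K) :=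
  DirectSum {
    sum_space :> lmodType K;
    sum_inj : forall i, {linear A i -> sum_space};
    sum_decomp : forall b : sum_space,
      exists! x : (forall i, A i), b = \sum_(i : I) sum_inj i (x i)
  }.

(* Families of modes: Y a r b is the coefficient a_(r) b of z^(-r-1) in
   Y(a, z) b.  The exponents r are in int for vertex algebras and their
   modules, and in the base field for intertwining operators. *)

Section Modes.
Variables (K : fieldType) (E : pzRingType).

Definition mode_bilinear (A B D : lmodType K) (Y : A -> E -> B -> D) : Prop :=
  (forall r b, linear (fun a => Y a r b)) /\ (forall a r, linear (Y a r)).

Definition mode_truncated (A B D : lmodType K) (Y : A -> E -> B -> D) : Prop :=
  forall a r b, \forall N \near \oo, Y a (r + N%:R) b = 0.

Definition int_binomial (m : int) (i : nat) : K :=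
  (\prod_(j < i) (m - j%:Z)%:~R) / (i`!)%:R.

(* Component form of the Jacobi identity
     x0^-1 delta((x1-x2)/x0) YD(u,x1) Y(a,x2) b
     - x0^-1 delta((x2-x1)/(-x0)) Y(a,x2) YB(u,x1) b
     = x2^-1 delta((x1-x0)/x2) Y(YA(u,x0) a, x2) b.
   By truncation both sums have finitely many nonzero terms, so the infinite
   sums are the partial sums for all large N. *)
Definition borcherds_identity (V A B D : lmodType K)
    (YA : V -> int -> A -> A) (YB : V -> int -> B -> B) (YD : V -> int -> D -> D)
    (Y : A -> E -> B -> D) : Prop :=
  forall (u : V) (a : A) (b : B) (l m : int) (r : E), \forall N \near \oo,
    \sum_(i < N)
      int_binomial m i *: Y (YA u (l + i%:Z) a) (m%:~R + r - i%:R) b =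
    \sum_(i < N)
      ((-1) ^+ i * int_binomial l i) *:
        (YD u (m + l - i%:Z) (Y a (r + i%:R) b)
         - (-1) ^ l *: Y a (l%:~R + r - i%:R) (YB u (m + i%:Z) b)).

End Modes.

Record vertexAlgebra (K : fieldType) := VertexAlgebra {
  va_space :> lmodType K;
  vacuum : va_space;
  va_mode : va_space -> int -> va_space -> va_space;
  va_bilinear : mode_bilinear va_mode;
  va_truncated : mode_truncated va_mode;
  va_vacuum : forall n v, va_mode vacuum n v = if n == -1 then v else 0;
  va_creation : forall u, va_mode u (-1) vacuum = u;
  va_creation0 : forall u (n : nat), va_mode u n%:Z vacuum = 0;
  va_borcherds : borcherds_identity va_mode va_mode va_mode va_mode
}.

Record vaModule (K : fieldType) (V : vertexAlgebra K) := VAModule {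
  vam_space :> lmodType K;
  vam_mode : V -> int -> vam_space -> vam_space;
  vam_bilinear : mode_bilinear vam_mode;
  vam_truncated : mode_truncated vam_mode;
  vam_vacuum : forall n w, vam_mode (vacuum V) n w = if n == -1 then w else 0;
  vam_borcherds : borcherds_identity (@va_mode K V) vam_mode vam_mode vam_mode
}.

Definition adjoint_module (K : fieldType) (V : vertexAlgebra K) : vaModule V :=
  @VAModule K V V (@va_mode K V) (va_bilinear V) (@va_truncated K V)
    (@va_vacuum K V) (@va_borcherds K V).

Definition simple_module (K : fieldType) (V : vertexAlgebra K)
    (W : vaModule V) : Prop :=
  (exists w : W, w != 0) /\
  forall P : set W,
    P 0 -> (forall (a : K) (x y : W), P x -> P y -> P (a *: x + y)) ->
    (forall (u : V) n (x : W), P x -> P (vam_mode u n x)) ->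
    (forall x, P x -> x = 0) \/ (forall x, P x).

(* sl(2) is the space of traceless 2 x 2 matrices, with the invariant form
   (x | y) = tr(xy), for which the long roots have squared length 2.  The map J
   below is used on traceless matrices only. *)

Section Sl2.
Variable K : fieldType.

Definition sl2E : 'M[K]_2 := delta_mx ord0 ord_max.
Definition sl2F : 'M[K]_2 := delta_mx ord_max ord0.
Definition sl2H : 'M[K]_2 := delta_mx ord0 ord0 - delta_mx ord_max ord_max.

Variables (V : vertexAlgebra K) (J : {linear 'M[K]_2 -> V}).

(* V is L(k,0): a simple vertex algebra generated by currents x(z), x in sl(2),
   with x(z) y(w) ~ k (x|y) / (z-w)^2 + [x,y](w) / (z-w).  For k = 0 this is
   the one-dimensional vertex algebra, with zero currents. *)
Definition is_simple_affine_sl2 (k : nat) : Prop :=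
  [/\ forall x y, \tr x = 0 -> \tr y = 0 ->
        [/\ va_mode (J x) 0 (J y) = J (x *m y - y *m x),
            va_mode (J x) 1 (J y) = (k%:R * \tr (x *m y)) *: vacuum V
          & forall n : nat, va_mode (J x) n.+2%:Z (J y) = 0],
      forall P : set V,
        P (vacuum V) -> (forall x, \tr x = 0 -> P (J x)) ->
        (forall (a : K) u v, P u -> P v -> P (a *: u + v)) ->
        (forall u n v, P u -> P v -> P (va_mode u n v)) ->
        forall v, P v
    & simple_module (adjoint_module V)].

Definition is_affine_simple_module (mu : nat) (W : vaModule V) : Prop :=
  simple_module W /\
  exists w : W,
    [/\ w != 0, vam_mode (J sl2E) 0 w = 0,
        vam_mode (J sl2H) 0 w = mu%:R *: w
      & forall x (n : nat), \tr x = 0 -> vam_mode (J x) n.+1%:Z w = 0].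

(* The Sugawara conformal vector of V at level k. *)
Definition sugawara (k : nat) : V :=
  (2 * (k%:R + 2))^-1 *:
    (va_mode (J sl2E) (-1) (J sl2F) + va_mode (J sl2F) (-1) (J sl2E)
     + 2^-1 *: va_mode (J sl2H) (-1) (J sl2H)).

End Sl2.

(* The space of intertwining operators of type (W3 over W1 W2), where omega is
   the conformal vector, so that omega_(0) is L(-1). *)

Section Intertwining.
Variables (K : fieldType) (V : vertexAlgebra K) (omega : V).
Variables (W1 W2 W3 : vaModule V).

Definition is_intertwining (Y : W1 -> K -> W2 -> W3) : Prop :=
  [/\ mode_bilinear Y, mode_truncated Y,
      borcherds_identity (@vam_mode K V W1) (@vam_mode K V W2)
        (@vam_mode K V W3) Y
    & forall w1 r w2,
        Y (vam_mode omega 0 w1) r w2 = - (r *: Y w1 (r - 1) w2)].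

Definition intertwining_pred : {pred W1 -> K -> W2 -> W3} :=
  fun Y => `[< is_intertwining Y >].

Lemma intertwining_submod_closed : submod_closed intertwining_pred.
Proof.
have modeB (A : lmodType K) (Z : V -> int -> A -> A) : mode_bilinear Z ->
    forall (c : K) u n x y, Z u n (c *: x + y) = c *: Z u n x + Z u n y.
  by move=> [_ h] c u n x y; rewrite h.
have mode0 (A : lmodType K) (Z : V -> int -> A -> A) : mode_bilinear Z ->
    forall u n, Z u n 0 = 0.
  move=> [_ h] u n; have /eqP := h u n 1 0 0.
  by rewrite !scale1r addr0 -subr_eq subrr => /eqP.
have comb (s t c : K) (x1 x2 y1 y2 : W3) :
    c *: (s *: (x1 - t *: y1)) + s *: (x2 - t *: y2) =
    s *: (c *: x1 + x2 - t *: (c *: y1 + y2)).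
  rewrite scalerA [c * s]mulrC -scalerA -scalerDr scalerBr addrACA -opprD.
  by rewrite [t *: (_ + _)]scalerDr !scalerA [c * t]mulrC.
split.
  apply/asboolP; split.
  - by split=> *; move=> c x y; rewrite /= scaler0 addr0.
  - by move=> a r b; apply: nearW.
  - move=> u a b l m r; apply: nearW => N.
    rewrite !big1 // => i _; last by rewrite scaler0.
    by rewrite (mode0 _ _ (vam_bilinear W3)) scaler0 subrr scaler0.
  - by move=> w1 r w2 /=; rewrite scaler0 oppr0.
move=> c Y Z /asboolP[Yb Yt YB Yd] /asboolP[Zb Zt ZB Zd].
apply/asboolP; split.
- split=> [r b d x y|a r d x y] /=; rewrite /= ?fctE.
    rewrite (Yb.1 r b) (Zb.1 r b) !scalerDr !scalerA mulrC.
    by rewrite addrACA.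
  rewrite (Yb.2 a r) (Zb.2 a r) !scalerDr !scalerA mulrC.
  by rewrite addrACA.
- move=> a r b; near=> N; rewrite !fctE.
  rewrite (_ : Y _ _ _ = 0); last by near: N; exact: Yt.
  rewrite (_ : Z _ _ _ = 0); last by near: N; exact: Zt.
  by rewrite scaler0 addr0.
- move=> u a b l m r; near=> N; rewrite !fctE.
  have eY : \sum_(i < N)
      int_binomial K m i *: Y (vam_mode u (l + i%:Z) a) (m%:~R + r - i%:R) b =
    \sum_(i < N)
      ((-1) ^+ i * int_binomial K l i) *:
        (vam_mode u (m + l - i%:Z) (Y a (r + i%:R) b)
         - (-1) ^ l *: Y a (l%:~R + r - i%:R) (vam_mode u (m + i%:Z) b)).
    by near: N; exact: YB.
  have eZ : \sum_(i < N)
      int_binomial K m i *: Z (vam_mode u (l + i%:Z) a) (m%:~R + r - i%:R) b =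
    \sum_(i < N)
      ((-1) ^+ i * int_binomial K l i) *:
        (vam_mode u (m + l - i%:Z) (Z a (r + i%:R) b)
         - (-1) ^ l *: Z a (l%:~R + r - i%:R) (vam_mode u (m + i%:Z) b)).
    by near: N; exact: ZB.
  transitivity (c *: (\sum_(i < N)
      int_binomial K m i *: Y (vam_mode u (l + i%:Z) a) (m%:~R + r - i%:R) b)
    + \sum_(i < N)
      int_binomial K m i *: Z (vam_mode u (l + i%:Z) a) (m%:~R + r - i%:R) b).
    rewrite scaler_sumr -big_split /=; apply: eq_bigr => i _.
    by rewrite scalerDr !scalerA mulrC.
  rewrite eY eZ scaler_sumr -big_split /=; apply: eq_bigr => i _.
  by rewrite comb -(modeB _ _ (vam_bilinear W3)).
- move=> w1 r w2; rewrite !fctE Yd Zd scalerDr opprD !scalerN !scalerA.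
  by rewrite mulrC.
Unshelve. all: by end_near.
Qed.

HB.instance Definition _ :=
  GRing.isSubmodClosed.Build K (W1 -> K -> W2 -> W3) intertwining_pred
    intertwining_submod_closed.

Record intertwiningOperator := IntertwiningOperator {
  intw_val :> W1 -> K -> W2 -> W3;
  _ : intw_val \in intertwining_pred
}.

HB.instance Definition _ := [isSub for intw_val].
HB.instance Definition _ := [Choice of intertwiningOperator by <:].
HB.instance Definition _ :=
  [SubChoice_isSubLmodule of intertwiningOperator by <:].

End Intertwining.

(* The fusion rule N^nu_{lam mu} at level k. *)
Definition fusion (k lam mu nu : nat) : nat :=
  [&& `|lam%:Z - mu%:Z| <= nu%:Z,
      (nu <= minn (lam + mu) (2 * k - lam - mu))%N
    & ~~ odd (lam + mu + nu)].

(* A weight lambda_(i+1) is lam i for i < n, and a chain (mu_0 .. mu_(n-1)) is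
   a function on 'I_n; ordS is the cyclic successor, so mu_n = mu_0. *)

Definition fusion_chain (k n : nat) (lam : 'I_n -> 'I_k.+1)
    (mu : {ffun 'I_n -> 'I_k.+1}) : bool :=
  [forall i, fusion k (lam i) (mu i) (mu (ordS i)) == 1%N].

Section ConformalBlocks.
Variables (K : fieldType) (V : vertexAlgebra K) (omega : V) (k : nat).
Variables (L : 'I_k.+1 -> vaModule V) (n : nat) (lam : 'I_n -> 'I_k.+1).

Definition block_factor (mu : {ffun 'I_n -> 'I_k.+1}) (i : 'I_n) : lmodType K :=
  intertwiningOperator omega (L (lam i)) (L (mu i)) (L (mu (ordS i))).

Record conformalBlocks := ConformalBlocks {
  bl_summand : forall mu : {ffun 'I_n -> 'I_k.+1},
    tensorProduct (block_factor mu);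
  bl_space :> directSum (fun mu => tensor_space (bl_summand mu))
}.

End ConformalBlocks.

Definition Smatrix (R : realType) (k : nat) : 'M[R]_k.+1 :=
  \matrix_(i, j)
    (Num.sqrt (2 / (k%:R + 2))
     * sin (pi * (i%:R + 1) * (j%:R + 1) / (k%:R + 2))).

(* Main.v *)
(* A tensor product of spaces of dimension 0 or 1 has dimension the product of
   these dimensions, so the dimension of Bl is the number of fusion chains.  By
   2 sin x sin t = cos (x - t) - cos (x + t), the sum of
   N^nu_{lam mu} sin ((nu + 1) t) over nu telescopes for t = pi (j + 1) / (k + 2),
   which shows that column j of S is an eigenvector of N_lam with eigenvalue
   S_{lam j} / S_{0 j}.  As S is an orthogonal matrix, the number of chains,
   tr (N_{lam_1} ... N_{lam_n}), is the sum over j of the products of these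
   eigenvalues. *)

From HB Require Import structures.
Require Import Defs.
From mathcomp Require Import ring lra zify.

Set Implicit Arguments.
Unset Strict Implicit.
Unset Printing Implicit Defensive.

Import Order.TTheory GRing.Theory Num.Theory.
Local Open Scope ring_scope.

(** * Dimensions of direct sums and tensor products *)

Section LinearAlgebra.
Variables (K : fieldType) (I : finType) (A : I -> lmodType K).

(** Bases of the summands together form a basis of the sum, so coordinates are indexed by the pairs
    in [{i & 'I_(d i)}], numbered by [enum_rank]. *)
Lemma directSum_has_dim (d : I -> nat) (S : directSum A) :
  (forall i, has_dim (A i) (d i)) -> has_dim S (\sum_i d i).
Proof.
move=> hd.
have cvg i : exists f : A i -> 'rV[K]_(d i), linear f /\ bijective f.
  by case: (hd i) => -[f]; exists f.
pose f i := projT1 (cid (cvg i)).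
have f_lin i : linear (f i) := (projT2 (cid (cvg i))).1.
have f_bij i : bijective (f i) := (projT2 (cid (cvg i))).2.
have [x xP] := choice (sum_decomp (d := S)).
have x_eq b y : b = \sum_i sum_inj S i (y i) -> x b = y by case: (xP b) => _; exact.
have -> : (\sum_i d i = #|{: {i & 'I_(d i)}}|)%N.
  by rewrite card_tagged sumnE big_map big_enum; apply: eq_bigr => i _; rewrite card_ord.
constructor.
exists (fun b => \row_t let s := enum_val t in f (tag s) (x b (tag s)) 0 (tagged s)).
  move=> a b c; apply/rowP => t; rewrite !mxE /=; set s := enum_val t.
  rewrite (x_eq _ (fun i => a *: x b i + x c i)) ?f_lin ?mxE //.
  rewrite {1}(xP b).1 {1}(xP c).1 scaler_sumr -big_split /=.
  by apply: eq_bigr => i _; rewrite linearP.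
have [g gP] : exists g : forall i, 'rV[K]_(d i) -> A i,
    forall i, cancel (f i) (g i) /\ cancel (g i) (f i).
  have h i : exists g, cancel (f i) g /\ cancel g (f i).
    by case: (f_bij i) => g; exists g.
  by exists (fun i => projT1 (cid (h i))) => i; exact: projT2 (cid (h i)).
exists (fun r : 'rV[K]_#|{: {i & 'I_(d i)}}| => \sum_i sum_inj S i
    (g i (\row_j r 0 (enum_rank (Tagged (fun i => 'I_(d i)) j))))).
  move=> b; rewrite [RHS](xP b).1; apply: eq_bigr => i _; congr (sum_inj S i _).
  rewrite -[RHS](gP i).1; congr (g i _); apply/rowP => j.
  by rewrite !mxE enum_rankK.
move=> r; apply/rowP => t; rewrite mxE /=.
rewrite (x_eq _ _ erefl) (gP _).2 mxE; congr (r 0 _).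
by rewrite -[RHS]enum_valK; congr enum_rank; case: (enum_val t).
Qed.

Lemma multilinear_scale (T : lmodType K) (t : (forall i, A i) -> T)
    (c : I -> K) (v : forall i, A i) :
  multilinear t -> t (fun i => c i *: v i) = (\prod_i c i) *: t v.
Proof.
move=> tl.
have scale (i : I) (w : forall j, A j) (a : K) (x : A i) :
    t (@dfwith I A w i (a *: x)) = a *: t (@dfwith I A w i x).
  (* [linear] is the single identity for [a *: x + y]; its case [a = 1], [x = y = 0] gives the value
     at 0. *)
  have t0 : t (@dfwith I A w i 0) = 0.
    have /eqP := tl i w 1 0 0.
    by rewrite !scale1r addr0 -subr_eq subrr => /eqP.
  by have := tl i w a x 0; rewrite addr0 t0 addr0.
(* Scaling only the slots listed in [s] lets the induction change one slot at a time. *)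
suff H s : uniq s ->
    t (fun i => if i \in s then c i *: v i else v i) = (\prod_(i <- s) c i) *: t v.
  have -> : \prod_i c i = \prod_(i <- enum I) c i by rewrite big_enum.
  rewrite -H ?enum_uniq //; congr t.
  by apply/functional_extensionality_dep => i; rewrite mem_enum inE.
elim: s => [|j s IH /= /andP[js us]].
  by rewrite big_nil scale1r.
rewrite big_cons -scalerA -IH //.
set w := fun i => if i \in s then _ else _.
have wj : w j = v j by rewrite /w (negPf js).
have <- : dfwith w j (v j) = w.
  apply/functional_extensionality_dep => i.
  by case: dfwithP.
rewrite -scale; congr t; apply/functional_extensionality_dep => i.
case: dfwithP => [|l jl]; first by rewrite inE eqxx.
by rewrite /w inE eq_sym (negPf jl).
Qed.

(** Scaling slot [i] by 0 and the others by 1 leaves [v] unchanged, while the product of the scalars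
    is 0. *)
Lemma multilinear_zero (T : lmodType K) (t : (forall i, A i) -> T)
    (v : forall i, A i) (i : I) :
  multilinear t -> v i = 0 -> t v = 0.
Proof.
move=> tl vi0; have := multilinear_scale (fun j => (j != i)%:R) v tl.
rewrite (bigD1 i) //= eqxx mul0r scale0r => <-; congr t.
apply/functional_extensionality_dep => j.
by case: eqVneq => [->|]; rewrite ?scale1r ?vi0 ?scaler0.
Qed.

(** Both maps factor the same multilinear map through [T], so the uniqueness in the universal
    property identifies them. *)
Lemma tensorProduct_hom_ext (T : tensorProduct A) (W : lmodType K)
    (h h' : {linear T -> W}) :
  (forall v, h (pure_tensor T v) = h' (pure_tensor T v)) -> h =1 h'.
Proof.
move=> hh'.
have gl : multilinear (fun v => h' (pure_tensor T v)).
  have tl := @pure_tensor_multilinear _ _ _ T.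
  by move=> i v a x y; rewrite tl linearP.
have [h0 [_ h0u]] := tensor_universal T gl.
by move=> z; rewrite (h0u h) // (h0u h').
Qed.

Lemma has_dim0P (M : lmodType K) : has_dim M 0 <-> forall x : M, x = 0.
Proof.
split=> [[[f fl [g fK gK]]] x|M0].
  by rewrite -[x]fK -[0]fK; congr g; apply/rowP => -[].
constructor; exists (fun=> 0); first by move=> a x y; rewrite scaler0 addr0.
by exists (fun=> 0) => [x|r]; [exact/esym/M0 | apply/rowP => -[]].
Qed.

Lemma has_dim1P (M : lmodType K) :
  has_dim M 1 <-> exists e (f : M -> K), [/\ scalar f, f e = 1 & forall x, x = f x *: e].
Proof.
split=> [[[f fl [g fK gK]]]|[e [f [fl fe fK]]]].
  exists (g 1), (fun x => f x 0 0); split.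
  - by move=> a x y; rewrite fl !mxE.
  - by rewrite gK mxE.
  move=> x; apply: (can_inj fK); have := fl (f x 0 0) (g 1) 0.
  have /eqP := fl 1 0 0; rewrite !scale1r addr0 -subr_eq subrr => /eqP <-.
  rewrite !addr0 => ->; rewrite gK; apply/rowP => j.
  by rewrite !mxE !ord1 mulr1.
constructor; exists (fun x => (f x)%:M).
  by move=> a x y; rewrite fl raddfD /= scale_scalar_mx.
exists (fun r : 'rV_1 => r 0 0 *: e) => [x|r]; first by rewrite mxE -fK.
apply/rowP => j; rewrite mxE ord1 /= mulr1n.
have := fl (r 0 0) e 0; have /eqP := fl 1 0 0.
by rewrite /= scale1r addr0 mul1r -subr_eq subrr => /eqP <-; rewrite !addr0 fe mulr1.
Qed.

(** All pure tensors vanish, so the identity and the zero map agree on them, hence everywhere. *)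
Lemma tensorProduct_has_dim0 (T : tensorProduct A) (i : I) :
  has_dim (A i) 0 -> has_dim T 0.
Proof.
move=> /has_dim0P Ai0; apply/has_dim0P => z.
have := @tensorProduct_hom_ext T T idfun \0; apply=> v /=.
by apply: multilinear_zero (Ai0 (v i)); exact: pure_tensor_multilinear.
Qed.

(** The product of the coordinate functionals [f i] induces a functional [h] on [T]. The pure tensor
    of the [e i] spans [T] because [H] agrees with the identity on pure tensors. *)
Lemma tensorProduct_has_dim1 (T : tensorProduct A) :
  (forall i, has_dim (A i) 1) -> has_dim T 1.
Proof.
move=> A1; have A1' i := (has_dim1P _).1 (A1 i).
pose e i := projT1 (cid (A1' i)).
pose f i := projT1 (cid (projT2 (cid (A1' i)))).
have efP i : [/\ scalar (f i), f i (e i) = 1 & forall x, x = f i x *: e i].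
  exact: projT2 (cid (projT2 (cid (A1' i)))).
have gl : multilinear (fun v => \prod_i f i (v i) : K^o).
  move=> i v a x y; rewrite !(bigD1 i (P := xpredT)) //= !dfwithin.
  have out (z : A i) : \prod_(j | j != i) f j (dfwith v i z j)
      = \prod_(j | j != i) f j (v j).
    by apply: eq_bigr => j ji; rewrite dfwithout // eq_sym.
  by have [fl _ _] := efP i; rewrite !out fl mulrDl -mulrA.
have [h [hP _]] := tensor_universal T gl.
apply/has_dim1P; exists (pure_tensor T e), h; split.
- by move=> a x y; rewrite linearP.
- by rewrite hP big1 // => i _; have [] := efP i.
have lin : linear (fun x : T => h x *: pure_tensor T e).
  by move=> a x y; rewrite linearP scalerDl scalerA.
pose H : {linear T -> T} := HB.pack (fun x : T => h x *: pure_tensor T e)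
  (GRing.isLinear.Build _ _ _ _ _ lin).
apply: (@tensorProduct_hom_ext T T idfun H) => v /=.
rewrite hP -(multilinear_scale _ _ (pure_tensor_multilinear T)); congr pure_tensor.
by apply/functional_extensionality_dep => i; have [] := efP i.
Qed.

End LinearAlgebra.

(** * Trigonometric sums *)

Section Trigonometry.
Variable R : realType.
Implicit Types (x y : R) (m n a b : nat).

Lemma mul2_sin_sin x y : 2 * (sin x * sin y) = cos (x - y) - cos (x + y).
Proof. by rewrite cosB cosD; ring. Qed.

(** Dirichlet kernel: [2 * sin (x / 2) * cos (n x)] is the difference of the sines of [(n + 1/2) x]
    and [(n - 1/2) x], so the sum telescopes. *)
Lemma sum_cos_half x n :
  2 * sin (x / 2) * (\sum_(a < n) cos (a%:R * x)) =
  sin ((n%:R - 1 / 2) * x) + sin (x / 2).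
Proof.
elim: n => [|n IH].
  by rewrite big_ord0 mulr0 (_ : (_ - _) * x = - (x / 2)) ?sinN ?addNr //; lra.
rewrite big_ord_recr /= mulrDr IH.
rewrite (_ : (n.+1%:R - 1 / 2) * x = n%:R * x + x / 2); last by rewrite -natr1; lra.
rewrite (_ : (n%:R - 1 / 2) * x = n%:R * x - x / 2); last by lra.
by rewrite sinB sinD; ring.
Qed.

Lemma sum_cos_pi n m : (0 < m < 2 * n)%N ->
  \sum_(a < n) cos (a%:R * (m%:R * pi / n%:R)) = (odd m)%:R :> R.
Proof.
move=> /andP[m_gt0 m_lt]; set x := m%:R * pi / n%:R.
have n_gt0 : 0 < n%:R :> R by rewrite ltr0n; lia.
(* The bounds on [m] put [x / 2] strictly between 0 and [pi]. *)
have sx : 0 < sin (x / 2).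
  apply: sin_gt0_pi; rewrite /x -mulrA -invfM; apply/andP; split.
    by rewrite divr_gt0 ?mulr_gt0 ?pi_gt0 // ltr0n.
  rewrite ltr_pdivrMr ?mulr_gt0 // mulrC ltr_pM2l ?pi_gt0 //.
  by rewrite -natrM ltr_nat mulnC.
have s0 : 2 * sin (x / 2) != 0 by rewrite mulf_neq0 ?gt_eqF.
apply: (mulfI s0); rewrite sum_cos_half.
(* As [n * x = m * pi], the first sine is [- (-1)^m sin (x / 2)], so the cosine sum is
   [(1 - (-1)^m) / 2]. *)
rewrite (_ : (n%:R - 1 / 2) * x = - (x / 2) + pi *+ m); last first.
  by rewrite -[pi *+ m]mulr_natl /x; field; rewrite gt_eqF.
rewrite (alternatingn (@sinDpi R)) sinN -signr_odd.
by case: (odd m) => /=; rewrite ?expr1 ?expr0; ring.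
Qed.

(** Orthogonality of the discrete sine transform: the product formula leaves cosine sums of
    frequencies [i - j] and [i + j + 2], which have equal parity and so cancel unless [i = j]. *)
Lemma sum_sin_sin n i j : (i < n)%N -> (j < n)%N ->
  \sum_(a < n) sin ((a%:R + 1) * ((i%:R + 1) * pi / n.+1%:R))
             * sin ((a%:R + 1) * ((j%:R + 1) * pi / n.+1%:R))
  = (i == j)%:R * (n.+1%:R / 2) :> R.
Proof.
wlog ij : i j / (j <= i)%N => [H|] i_lt j_lt.
  case: (leqP j i) => [/H|/ltnW/H]; first exact.
  by rewrite eq_sym => <- //; apply: eq_bigr => a _; rewrite mulrC.
set u := (i%:R + 1) * pi / _; set v := (j%:R + 1) * pi / _.
(* The added term [a = 0] vanishes; the range becomes that of [sum_cos_pi] for [n.+1]. *)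
transitivity (\sum_(a < n.+1) sin (a%:R * u) * sin (a%:R * v)).
  rewrite big_ord_recl mul0r sin0 mul0r add0r.
  by apply: eq_bigr => a _; rewrite lift0 -natr1.
have n0 : n.+1%:R != 0 :> R by rewrite pnatr_eq0.
apply: (@mulfI _ 2%:R); first by rewrite pnatr_eq0.
rewrite mulr_sumr (eq_bigr (fun a : 'I_n.+1 =>
  cos (a%:R * ((i - j)%:R * pi / n.+1%:R))
  - cos (a%:R * ((i + j).+2%:R * pi / n.+1%:R)))); last first.
  move=> a _; rewrite mul2_sin_sin /u /v natrB // -!natr1 natrD.
  by congr (cos _ - cos _); field.
rewrite big_split /= sumrN [X in _ - X]sum_cos_pi; last lia.
case: eqVneq => [->|ne].
  rewrite subnn (eq_bigr (fun=> 1)) => [|a _]; last by rewrite !mul0r mulr0 cos0.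
  rewrite sumr_const card_ord /= negbK addnn odd_double subr0 mul1r.
  by rewrite mulrC divfK ?pnatr_eq0.
rewrite sum_cos_pi; last lia.
by rewrite oddB // /= negbK oddD subrr mul0r mulr0.
Qed.

Lemma telescope_step2 (c : nat -> R) n a p : (a + 2 * p < n)%N ->
  \sum_(v < n | [&& (a <= v)%N, (v <= a + 2 * p)%N & ~~ odd (a + v)])
     (c v - c v.+2) = c a - c (a + 2 * p).+2.
Proof.
elim: p => [|p IH] lt_n.
  have a_lt : (a < n)%N by lia.
  rewrite (big_pred1 (Ordinal a_lt)) ?addn0 // => v.
  by rewrite /= -val_eqE /=; lia.
rewrite (bigD1 (Ordinal lt_n)) /=; last lia.
rewrite (eq_bigl (fun v : 'I_n =>
  [&& (a <= v)%N, (v <= a + 2 * p)%N & ~~ odd (a + v)])); last first.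
  by move=> v; rewrite -val_eqE /=; lia.
rewrite IH; last lia.
by rewrite mulnS addnCA; ring.
Qed.

End Trigonometry.

(** * Fusion rules and the S-matrix *)

Section Verlinde.
Variables (R : realType) (k : nat).
Implicit Types (lam mu nu j : 'I_k.+1).

Let theta (j : nat) : R := pi * (j%:R + 1) / (k%:R + 2).

(** The upper bound [min (lam + mu, 2k - lam - mu)] exceeds [|lam - mu|] by exactly [2 * p], so the
    admissible [nu] form a progression of step two, as [telescope_step2] requires. *)
Lemma fusionE (lam mu nu : 'I_k.+1) :
  let a := (maxn lam mu - minn lam mu)%N in
  let p := (minn (minn lam mu) (k - maxn lam mu))%N in
  fusion k lam mu nu = [&& (a <= nu)%N, (nu <= a + 2 * p)%N & ~~ odd (a + nu)].
Proof.
have := ltn_ord lam; have := ltn_ord mu; have := ltn_ord nu.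
move: (nat_of_ord lam) (nat_of_ord mu) (nat_of_ord nu) => l m n ? ? ? /=.
by rewrite /fusion; congr nat_of_bool; lia.
Qed.

(* If lam + mu > k, the upper limit of the sum over nu is 2 k - lam - mu, and the
   last cosine is that of the case lam + mu <= k because (k + 2) theta j is an
   integral multiple of pi. *)
Lemma sum_fusion_sin (lam mu j : 'I_k.+1) :
  (\sum_(nu < k.+1) (fusion k lam mu nu)%:R * sin (nu.+1%:R * theta j))
    * sin (theta j) =
  sin (lam.+1%:R * theta j) * sin (mu.+1%:R * theta j).
Proof.
have two0 : 2 != 0 :> R by rewrite pnatr_eq0.
apply: (mulfI two0); rewrite mul2_sin_sin.
pose c (m : nat) := cos (m%:R * theta j).
set a := (maxn lam mu - minn lam mu)%N.
set p := (minn (minn lam mu) (k - maxn lam mu))%N.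
have hl := ltn_ord lam; have hm := ltn_ord mu.
have -> : 2 * ((\sum_(nu < k.+1) (fusion k lam mu nu)%:R
       * sin (nu.+1%:R * theta j)) * sin (theta j)) = c a - c (a + 2 * p).+2.
  rewrite -(@telescope_step2 _ c k.+1); last by rewrite /a /p; lia.
  rewrite mulr_suml mulr_sumr [RHS]big_mkcond /=; apply: eq_bigr => nu _.
  rewrite fusionE -/a -/p; case: ifP => _; last by rewrite !mul0r mulr0.
  by rewrite mul1r mul2_sin_sin /c -!natr1; congr (cos _ - cos _); ring.
congr (_ - _).
  rewrite -mulrBl /c /a; case: (leqP lam mu) => h.
    by rewrite natrB // -!natr1 -cosN; congr cos; ring.
  by rewrite natrB 1?ltnW // -!natr1; congr cos; ring.
rewrite -mulrDl /c; case: (leqP (lam + mu) k) => h.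
  have -> : (a + 2 * p = lam + mu)%N by rewrite /a /p; lia.
  by rewrite -!natr1 natrD; congr cos; ring.
have -> : (a + 2 * p = 2 * k - (lam + mu))%N by rewrite /a /p; lia.
rewrite -cosN -[LHS](periodicn (@cosD2pi R) j.+1); congr cos.
rewrite -natr1 -[(_ - _).+1%:R]natr1 natrB; last lia.
rewrite -[_ *+ j.+1]mulr_natl -[pi *+ 2]mulr_natl -!natr1 natrD natrM /theta.
by field; rewrite -natrD pnatr_eq0 addn2.
Qed.

Lemma SmatrixE (i j : 'I_k.+1) :
  Smatrix R k i j = Num.sqrt (2 / (k%:R + 2)) * sin (i.+1%:R * theta j).
Proof. by rewrite mxE /theta -natr1; congr (_ * sin _); ring. Qed.

Lemma Smatrix_sym (i j : 'I_k.+1) : Smatrix R k i j = Smatrix R k j i.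
Proof. by rewrite !mxE; congr (_ * sin (_ / _)); ring. Qed.

Let c_gt0 : 0 < 2 / (k%:R + 2) :> R.
Proof. by rewrite divr_gt0 // -natrD ltr0n addn2. Qed.

(** For [j <= k] the angle [theta j] lies strictly between 0 and [pi]. *)
Lemma Smatrix_ord0_neq0 (j : 'I_k.+1) : Smatrix R k ord0 j != 0.
Proof.
rewrite SmatrixE mul1r gt_eqF // mulr_gt0 ?sqrtr_gt0 //.
have k2 : 0 < k%:R + 2 :> R by rewrite -natrD ltr0n addn2.
apply: sin_gt0_pi; rewrite divr_gt0 ?mulr_gt0 ?pi_gt0 ?natr1 //=.
by rewrite ltr_pdivrMr // ltr_pM2l ?pi_gt0 // natr1 -natrD ltr_nat addn2 ltnS ltn_ord.
Qed.

Lemma Smatrix_orthonormal (i j : 'I_k.+1) :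
  \sum_a Smatrix R k i a * Smatrix R k a j = (i == j)%:R.
Proof.
have := @sum_sin_sin R k.+1 i j (ltn_ord i) (ltn_ord j).
have k2 : (k.+2)%:R = k%:R + 2 :> R by rewrite -addn2 natrD.
(* The factor is the square of the normalization of S and cancels [(k + 2) / 2], the value of the
   diagonal sine sum. *)
move=> /(congr1 (fun z => 2 / (k%:R + 2) * z)); rewrite k2 mulrCA.
rewrite -[2 / _ * (_ / 2)]mulrA [_^-1 * _]mulrA mulVf -?k2 ?pnatr_eq0 // mul1r.
rewrite divff ?pnatr_eq0 // mulr1 => <-; rewrite k2 mulr_sumr.
apply: eq_bigr => a _; rewrite (Smatrix_sym i a) !mxE.
rewrite -[X in _ = X * _](sqr_sqrtr (ltW c_gt0)).
set c := Num.sqrt _; rewrite mulrACA expr2; congr (_ * (sin _ * sin _)); field.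
all: by rewrite -k2 pnatr_eq0.
Qed.

Lemma verlinde_eigen (lam mu j : 'I_k.+1) :
  \sum_(nu < k.+1) (fusion k lam mu nu)%:R * Smatrix R k nu j =
  Smatrix R k lam j / Smatrix R k ord0 j * Smatrix R k mu j.
Proof.
have S0 := Smatrix_ord0_neq0 j.
apply: (mulIf S0); rewrite mulrAC divfK // !SmatrixE mul1r.
rewrite mulrACA -sum_fusion_sin mulrACA; congr (_ * _); rewrite mulr_sumr.
by apply: eq_bigr => nu _; rewrite SmatrixE mulrCA.
Qed.

(** The eigenvector identity reads [N S = S D]; multiplying on the right by S, which is its own
    inverse, gives [N = S D S]. *)
Lemma verlinde_fusion (lam mu nu : 'I_k.+1) :
  (fusion k lam mu nu)%:R =
  \sum_(j < k.+1) Smatrix R k mu j * (Smatrix R k lam j / Smatrix R k ord0 j)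
         * Smatrix R k j nu.
Proof.
under eq_bigr => j _ do rewrite [_ mu j * _]mulrC -verlinde_eigen mulr_suml.
rewrite exchange_big /= (bigD1 nu) //=.
under eq_bigr => j _ do rewrite -mulrA.
rewrite -mulr_sumr Smatrix_orthonormal eqxx mulr1 big1 ?addr0 // => a anu.
under eq_bigr => j _ do rewrite -mulrA.
by rewrite -mulr_sumr Smatrix_orthonormal (negPf anu) mulr0.
Qed.

End Verlinde.

(** * Cyclic sums as traces *)

Lemma ordS_invariant_const (T : Type) n (f : 'I_n.+1 -> T) :
  (forall i, f (ordS i) = f i) -> forall i, f i = f ord0.
Proof.
move=> fS [m]; elim: m => [|m IH] lt_m; first by congr f; exact: val_inj.
rewrite -(IH (ltnW lt_m)) -[RHS]fS; congr f; apply: val_inj => /=.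
by rewrite modn_small.
Qed.

(* Expanding each N in terms of P, D, Q and summing over mu first leaves a sum
   over f with a factor [f (i - 1) == f i] for each i, so that only the constant
   f contribute. *)
Lemma sum_cyclic_diagonalizable (F : comRingType) (I : finType) n
    (N : 'I_n.+1 -> I -> I -> F) (P Q : I -> I -> F) (D : 'I_n.+1 -> I -> F) :
  (forall i a b, N i a b = \sum_j P a j * D i j * Q j b) ->
  (forall i j, \sum_a Q i a * P a j = (i == j)%:R) ->
  \sum_(mu : {ffun 'I_n.+1 -> I}) \prod_i N i (mu i) (mu (ordS i)) =
  \sum_j \prod_i D i j.
Proof.
move=> NE QP.
under eq_bigr => mu _ do under eq_bigr => i _ do rewrite NE.
under eq_bigr => mu _ do rewrite bigA_distr_bigA.
rewrite exchange_big /=.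
transitivity (\sum_(f : {ffun 'I_n.+1 -> I})
    \prod_i (D i (f i) * (f (ord_pred i) == f i)%:R)).
  apply: eq_bigr => f _.
  under [RHS]eq_bigr => i _ do rewrite -QP.
  rewrite [RHS]big_split /= bigA_distr_bigA mulr_sumr; apply: eq_bigr => mu _.
  (* Shifting the index of the [Q] factors by [ordS] matches them to the expansion of [N i], where
     [Q] carries [mu (ordS i)]. *)
  have -> : \prod_i (Q (f (ord_pred i)) (mu i) * P (mu i) (f i)) =
      (\prod_i Q (f i) (mu (ordS i))) * \prod_i P (mu i) (f i).
    rewrite big_split (reindex_inj (@ordS_inj _)) /=; congr (_ * _).
    by apply: eq_bigr => i _; rewrite ordSK.
  by rewrite 2!big_split /= mulrC [_ * \prod_i D _ _]mulrC mulrCA.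
pose cst (j : I) : {ffun 'I_n.+1 -> I} := [ffun=> j].
have cstK : cancel cst (fun f => f ord0) by move=> j; rewrite ffunE.
rewrite (bigID (fun f : {ffun 'I_n.+1 -> I} => f == cst (f ord0))) /=.
rewrite [X in _ + X]big1 ?addr0.
  rewrite (reindex cst) /=; last first.
    by exists (fun f => f ord0) => [j _|f]; rewrite ?cstK // inE => /eqP <-.
  apply: eq_big => [j|j _]; first by rewrite cstK eqxx.
  by apply: eq_bigr => i _; rewrite !ffunE eqxx mulr1.
move=> f fne; have [i fi] : exists i, f (ord_pred i) != f i.
  apply/existsP; apply: contraNT fne; rewrite negb_exists => /forallP fS.
  apply/eqP/ffunP => i; rewrite ffunE; apply: ordS_invariant_const => {}i.
  by have := fS (ordS i); rewrite ordSK negbK => /eqP.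
by rewrite (bigD1 i) //= (negPf fi) mulr0 mul0r.
Qed.

(** * Counting fusion chains *)

Lemma fusion_chainPn (k n : nat) (lam : 'I_n -> 'I_k.+1)
    (mu : {ffun 'I_n -> 'I_k.+1}) :
  ~~ fusion_chain lam mu -> exists i, fusion k (lam i) (mu i) (mu (ordS i)) = 0%N.
Proof.
move=> nchain.
case: (pickP [pred i | fusion k (lam i) (mu i) (mu (ordS i)) == 0%N]) => [i /eqP|h].
  by exists i.
case/forallP: nchain => i; have := h i; rewrite /= /fusion.
by case: [&& _, _ & _].
Qed.

Lemma fusion_chain_prod (k n : nat) (lam : 'I_n -> 'I_k.+1)
    (mu : {ffun 'I_n -> 'I_k.+1}) :
  fusion_chain lam mu = (\prod_i fusion k (lam i) (mu i) (mu (ordS i)))%N :> nat.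
Proof.
case: (boolP (fusion_chain lam mu)) => [/forallP h|/fusion_chainPn[i hi]].
  by rewrite big1 // => i _; exact/eqP.
by rewrite (bigD1 i) //= hi.
Qed.

(** The length is [n.+1] because for length 0 the empty chain counts once, while the right-hand side
    would be [k + 1]. *)
Lemma sum_fusion_chain (R : realType) (k n : nat) (lam : 'I_n.+1 -> 'I_k.+1) :
  (\sum_(mu : {ffun 'I_n.+1 -> 'I_k.+1}) fusion_chain lam mu)%:R =
  \sum_(j < k.+1) (\prod_(i < n.+1) Smatrix R k (lam i) j)
     / Smatrix R k ord0 j ^+ n.+1 :> R.
Proof.
rewrite natr_sum.
transitivity (\sum_(mu : {ffun 'I_n.+1 -> 'I_k.+1})
    \prod_i (fusion k (lam i) (mu i) (mu (ordS i)))%:R : R).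
  by apply: eq_bigr => mu _; rewrite fusion_chain_prod natr_prod.
rewrite (sum_cyclic_diagonalizable (fun i => verlinde_fusion R (lam i))
  (@Smatrix_orthonormal R k)).
by apply: eq_bigr => j _; rewrite big_split /= prodfV prodr_const card_ord.
Qed.

(** Adding the parity conditions around the cycle counts each [mu i] twice. *)
Lemma fusion_chain_even (k n : nat) (lam : 'I_n -> 'I_k.+1)
    (mu : {ffun 'I_n -> 'I_k.+1}) :
  fusion_chain lam mu -> ~~ odd (\sum_i lam i).
Proof.
move=> /forallP chain; suff : ~~ odd (\sum_i (lam i + mu i + mu (ordS i))).
  have E : (\sum_i mu (ordS i) = \sum_i mu i)%N.
    by rewrite [RHS](reindex_inj (@ordS_inj _)).
  by rewrite 2!big_split /= E -addnA oddD addnn odd_double addbF.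
elim/big_ind: _ => // [x y /negPf ox /negPf oy|i _]; first by rewrite oddD ox oy.
by have := chain i; rewrite /fusion; case: and3P => // -[].
Qed.

(** * Two-point chains of type (k, k) *)

Lemma ord2_cases (i : 'I_2) : i = ord0 \/ i = ord_max.
Proof. by case: i => -[|[|//]] ?; [left|right]; exact: val_inj. Qed.

(** For [lam = k] the lower bound [|k - a|] and the upper bound [2k - k - a] both equal [k - a], and
    the parity condition then holds. *)
Lemma fusion_chain_max (k : nat) (mu : {ffun 'I_2 -> 'I_k.+1}) :
  fusion_chain (fun=> ord_max) mu <-> (mu ord_max = k - mu ord0 :> nat)%N.
Proof.
have S0 : ordS ord0 = ord_max :> 'I_2 by exact: val_inj.
have S1 : ordS ord_max = ord0 :> 'I_2 by exact: val_inj.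
have := ltn_ord (mu ord0); have := ltn_ord (mu ord_max).
have -> : fusion_chain (fun=> ord_max) mu =
    (fusion k k (mu ord0) (mu ord_max) == 1%N) &&
    (fusion k k (mu ord_max) (mu ord0) == 1%N).
  apply/forallP/andP => [h|[h0 h1] i]; first
    by move: (h ord0) (h ord_max); rewrite S0 S1.
  by have [->|->] := ord2_cases i; rewrite ?S0 ?S1.
move: (nat_of_ord (mu ord0)) (nat_of_ord (mu ord_max)) => a b hb ha.
by rewrite /fusion !eqb1; lia.
Qed.

Lemma card_fusion_chain_max (k : nat) :
  (\sum_(mu : {ffun 'I_2 -> 'I_k.+1}) fusion_chain (fun=> ord_max) mu = k.+1)%N.
Proof.
(* [rev_ord a] is [k - a], so [chain] parametrizes the chains by their first entry. *)
pose chain (a : 'I_k.+1) : {ffun 'I_2 -> 'I_k.+1} :=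
  [ffun i => if i == ord0 then a else rev_ord a].
rewrite (bigID (fun mu => fusion_chain (fun=> ord_max) mu)) /=.
rewrite [X in (_ + X)%N]big1 ?addn0; last by move=> mu /negPf ->.
rewrite (reindex chain) /=; last first.
  exists (fun mu => mu ord0) => [a _|mu]; first by rewrite ffunE.
  rewrite inE => /fusion_chain_max mu1; apply/ffunP => i; rewrite ffunE.
  by have [->|->] := ord2_cases i; rewrite //=; apply: val_inj; rewrite /= subSS.
have chainP a : fusion_chain (fun=> ord_max) (chain a).
  by apply/fusion_chain_max; rewrite !ffunE /= subSS.
rewrite (eq_big xpredT (fun=> 1%N)) => [|a|a _]; rewrite ?chainP //.
by rewrite sum1_card card_ord.
Qed.

(** * Dimensions of the conformal block spaces *)

Section BlockDimension.
Variables (K : fieldType) (V : vertexAlgebra K) (omega : V) (k : nat).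
Variable L : 'I_k.+1 -> vaModule V.
Hypothesis fusion_dim : forall lam mu nu : 'I_k.+1,
  has_dim (intertwiningOperator omega (L lam) (L mu) (L nu)) (fusion k lam mu nu).

(** Along a chain all factors are lines; otherwise some factor is zero and kills the tensor
    product. *)
Lemma summand_has_dim (n : nat) (lam : 'I_n -> 'I_k.+1)
    (mu : {ffun 'I_n -> 'I_k.+1})
    (T : tensorProduct (block_factor omega L lam mu)) :
  has_dim T (fusion_chain lam mu).
Proof.
have dimA i := fusion_dim (lam i) (mu i) (mu (ordS i)).
case: (boolP (fusion_chain lam mu)) => [/forallP h|/fusion_chainPn[i hi]].
  by apply: tensorProduct_has_dim1 => i; rewrite -(eqP (h i)); exact: dimA.
by apply: (@tensorProduct_has_dim0 _ _ _ _ i); rewrite -hi; exact: dimA.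
Qed.

Lemma conformalBlocks_has_dim (n : nat) (lam : 'I_n -> 'I_k.+1)
    (Bl : conformalBlocks omega L lam) :
  has_dim Bl (\sum_mu fusion_chain lam mu).
Proof. by apply: directSum_has_dim => mu; exact: summand_has_dim. Qed.

End BlockDimension.

Theorem proposition4p2 (R : realType) (k : nat)
    (V : vertexAlgebra R[i]) (J : {linear 'M[R[i]]_2 -> V})
    (hV : is_simple_affine_sl2 J k)
    (L : 'I_k.+1 -> vaModule V)
    (hL : forall mu : 'I_k.+1, is_affine_simple_module J mu (L mu))
    (hN : forall lam mu nu : 'I_k.+1,
        has_dim (intertwiningOperator (sugawara J k) (L lam) (L mu) (L nu))
          (fusion k lam mu nu)) :
  (forall (n : nat) (hn : (1 <= n)%N) (lam : 'I_n -> 'I_k.+1)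
      (Bl : conformalBlocks (sugawara J k) L lam),
      (exists d : nat,
          has_dim Bl d /\
          d%:R = \sum_(j < k.+1)
                   (\prod_(i < n) Smatrix R k (lam i) j)
                   / Smatrix R k ord0 j ^+ n) /\
      (odd (\sum_(i < n) lam i)%N ->
          has_dim Bl 0 /\
          \sum_(j < k.+1)
             (\prod_(i < n) Smatrix R k (lam i) j)
             / Smatrix R k ord0 j ^+ n = 0))
  /\
  (forall Bl : conformalBlocks (sugawara J k) L (fun _ : 'I_2 => ord_max),
      has_dim Bl k.+1 /\
      (forall mu : {ffun 'I_2 -> 'I_k.+1},
          fusion_chain (fun _ : 'I_2 => ord_max) mu <->
          (mu ord_max = k - mu ord0 :> nat)%N) /\
      (forall mu : {ffun 'I_2 -> 'I_k.+1},
          has_dim (bl_summand Bl mu)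
            (fusion_chain (fun _ : 'I_2 => ord_max) mu))).
Proof.
split=> [[//|n] _ lam Bl|Bl].
  have dimBl := conformalBlocks_has_dim hN Bl; split.
    by exists (\sum_mu fusion_chain lam mu)%N; rewrite sum_fusion_chain.
  (* Both the dimension and the sum over [j] are the number of chains, which is 0 by parity. *)
  move=> odd_lam; rewrite -sum_fusion_chain; move: dimBl.
  rewrite big1 // => mu _; apply/eqP; rewrite eqb0.
  by apply: contraL odd_lam; exact: fusion_chain_even.
split.
  by have := conformalBlocks_has_dim hN Bl; rewrite card_fusion_chain_max.
by split=> mu; [exact: fusion_chain_max | exact: summand_has_dim].
Qed.
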